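(* Let $A=A^*\in\mathbb{Q}^{n\times n}$ be a quaternion Hermitian matrix with right eigenvalues $\lambda_1(A),\dots,\lambda_n(A)$. Let $i,j\in\{1,\dots,n\}$, let $v_i\in\mathbb{Q}^n$ be a unit eigenvector of $A$ corresponding to the right eigenvalue $\lambda_i(A)$, and let $v_{i,j}$ be its $j$-th entry. Let $M_j$ be the $(n-1)\times(n-1)$ submatrix of $A$ obtained by deleting the $j$-th row and the $j$-th column, with right eigenvalues $\lambda_1(M_j),\dots,\lambda_{n-1}(M_j)$. Then $$|v_{i,j}|^2\prod_{k=1;\,k\ne i}^{n}\bigl(\lambda_i(A)-\lambda_k(A)\bigr)=\prod_{k=1}^{n-1}\bigl(\lambda_i(A)-\lambda_k(M_j)\bigr).$$
   Context: $\mathbb{Q}$ denotes the division ring of real quaternions $a=a_0+a_1\mathbf{i}+a_2\mathbf{j}+a_3\mathbf{k}$ with $a_0,\dots,a_3\in\mathbb{R}$, conjugate $\bar a=a_0-a_1\mathbf{i}-a_2\mathbf{j}-a_3\mathbf{k}$ and modulus $|a|=\sqrt{a\bar a}$. $A^*$ is the conjugate transpose. A right eigenvalue $\lambda$ of $A$ with eigenvector $v\neq 0$ satisfies $Av=v\lambda$; $v$ is a unit vector if $v^*v=1$. A quaternion Hermitian matrix ($A=A^*$) of order $n$ has real right eigenvalues, listed with multiplicity as $\lambda_1,\dots,\lambda_n$, meaning that there is a unitary $V\in\mathbb{Q}^{n\times n}$ ($V^*V=E_n$, the identity matrix) with $V^*AV=\mathrm{diag}(\lambda_1,\dots,\lambda_n)$.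 Empty products equal $1$. *)

(* Defs.v *)
From HB Require Import structures.
From mathcomp Require Import all_boot all_order all_algebra.
From mathcomp Require Import ring lra.
From mathcomp Require Export reals.

Set Implicit Arguments.
Unset Strict Implicit.
Unset Printing Implicit Defensive.

Import Order.TTheory GRing.Theory Num.Theory.
Local Open Scope ring_scope.

Record quat (R : Type) := Quat { qre : R; qi : R; qj : R; qk : R }.

Section QuatRing.
Variable R : realType.
Implicit Types a b c : quat R.

Definition quat_tuple a := (qre a, qi a, qj a, qk a).
Definition tuple_quat (t : R * R * R * R) :=
  let: (x, y, z, w) := t in Quat x y z w.
Lemma quat_tupleK : cancel quat_tuple tuple_quat. Proof. by case. Qed.
HB.instance Definition _ := Choice.copy (quat R) (can_type quat_tupleK).

Lemma quatP a b :
  qre a = qre b -> qi a = qi b -> qj a = qj b -> qk a = qk b -> a = b.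
Proof. by case: a b => ? ? ? ? [? ? ? ?] /= -> -> -> ->. Qed.

Definition zeroq : quat R := Quat 0 0 0 0.
Definition oneq : quat R := Quat 1 0 0 0.
Definition oppq a := Quat (- qre a) (- qi a) (- qj a) (- qk a).
Definition addq a b :=
  Quat (qre a + qre b) (qi a + qi b) (qj a + qj b) (qk a + qk b).
(* Hamilton product: i^2 = j^2 = k^2 = -1, ij = k = - ji, jk = i, ki = j. *)
Definition mulq a b := Quat
  (qre a * qre b - qi a * qi b - qj a * qj b - qk a * qk b)
  (qre a * qi b + qi a * qre b + qj a * qk b - qk a * qj b)
  (qre a * qj b - qi a * qk b + qj a * qre b + qk a * qi b)
  (qre a * qk b + qi a * qj b - qj a * qi b + qk a * qre b).

Lemma addqA : associative addq.
Proof. by move=> a b c; apply: quatP; rewrite /= addrA. Qed.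
Lemma addqC : commutative addq.
Proof. by move=> a b; apply: quatP; rewrite /= addrC. Qed.
Lemma add0q : left_id zeroq addq.
Proof. by move=> a; apply: quatP; rewrite /= add0r. Qed.
Lemma addNq : left_inverse zeroq oppq addq.
Proof. by move=> a; apply: quatP; rewrite /= addNr. Qed.
HB.instance Definition _ :=
  GRing.isZmodule.Build (quat R) addqA addqC add0q addNq.

Lemma mulqA : associative mulq.
Proof. by move=> a b c; apply: quatP => /=; ring. Qed.
Lemma mul1q : left_id oneq mulq.
Proof. by move=> a; apply: quatP => /=; ring. Qed.
Lemma mulq1 : right_id oneq mulq.
Proof. by move=> a; apply: quatP => /=; ring. Qed.
Lemma mulqDl : left_distributive mulq addq.
Proof. by move=> a b c; apply: quatP => /=; ring. Qed.
Lemma mulqDr : right_distributive mulq addq.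
Proof. by move=> a b c; apply: quatP => /=; ring. Qed.
Lemma oneq_neq0 : oneq != 0.
Proof. by apply/eqP => -[] /eqP; rewrite oner_eq0. Qed.
HB.instance Definition _ := GRing.Zmodule_isNzRing.Build (quat R)
  mulqA mul1q mulq1 mulqDl mulqDr oneq_neq0.

Definition realq (x : R) : quat R := Quat x 0 0 0.
Definition conjq a : quat R := Quat (qre a) (- qi a) (- qj a) (- qk a).
(* [a * conjq a] is real (see [mulq_conjq]), so [qre] only changes its type. *)
Definition modq a : R := Num.sqrt (qre (a * conjq a)).

Lemma mulq_conjqE a :
  qre (a * conjq a) = qre a ^+ 2 + qi a ^+ 2 + qj a ^+ 2 + qk a ^+ 2.
Proof. by rewrite /=; ring. Qed.

Lemma mulq_conjq a : a * conjq a = realq (modq a ^+ 2).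
Proof.
have ge0 : 0 <= qre (a * conjq a) by rewrite mulq_conjqE !addr_ge0 ?sqr_ge0.
by rewrite /modq sqr_sqrtr //; apply: quatP => //=; ring.
Qed.

Lemma conjq_mul a : conjq a * a = realq (modq a ^+ 2).
Proof. by rewrite -mulq_conjq; apply: quatP => /=; ring. Qed.

Lemma modq_eq0 a : (modq a == 0) = (a == 0).
Proof.
rewrite /modq sqrtr_eq0 mulq_conjqE; apply/idP/eqP => [le0|->]; last first.
  by rewrite /= expr0n /= !addr0.
have [re0 i0 j0 k0] :
    [/\ qre a ^+ 2 = 0, qi a ^+ 2 = 0, qj a ^+ 2 = 0 & qk a ^+ 2 = 0].
  move: (sqr_ge0 (qre a)) (sqr_ge0 (qi a)) (sqr_ge0 (qj a)) (sqr_ge0 (qk a)).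
  by move: le0 => *; split; lra.
by apply: quatP; apply/eqP; rewrite -sqrf_eq0 ?re0 ?i0 ?j0 ?k0.
Qed.

Definition invq a : quat R := conjq a * realq (modq a ^- 2).

Lemma mulqV a : a != 0 -> a * invq a = 1.
Proof.
rewrite -modq_eq0 => a0; rewrite /invq mulrA mulq_conjq.
by apply: quatP; rewrite /= ?(mulr0, mul0r, subr0, addr0) // divff // expf_neq0.
Qed.

Lemma mulVq a : a != 0 -> invq a * a = 1.
Proof.
move=> a0; rewrite -[RHS](mulqV a0) /invq mulrA mulq_conjq.
rewrite (_ : conjq a * _ = realq (modq a ^- 2) * conjq a); last first.
  by apply: quatP => /=; ring.
rewrite -mulrA conjq_mul; apply: quatP => /=; ring.
Qed.

Lemma quat_unitP a b : b * a = 1 /\ a * b = 1 -> a != 0.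
Proof.
case=> ba1 _; apply/eqP => a0; move: ba1; rewrite a0 mulr0 => /esym/eqP.
by rewrite oner_eq0.
Qed.
Lemma invq_out : {in [predC [pred a : quat R | a != 0]], invq =1 id}.
Proof.
by move=> a; rewrite !inE negbK => /eqP ->; apply: quatP => /=; ring.
Qed.
(* The units are exactly the nonzero elements: [quat R] is a division ring. *)
HB.instance Definition _ := GRing.NzRing_hasMulInverse.Build (quat R)
  mulVq mulqV quat_unitP invq_out.
End QuatRing.

Section QuatMatrix.
Variable R : realType.

Definition conjmx m n (A : 'M[quat R]_(m, n)) : 'M[quat R]_(n, m) :=
  (map_mx (@conjq R) A)^T.

Definition hermitianq n (A : 'M[quat R]_n) : Prop := A = conjmx A.

Definition unitaryq n (V : 'M[quat R]_n) : Prop := conjmx V *m V = 1%:M.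

Definition unit_vectorq n (v : 'cV[quat R]_n) : Prop := conjmx v *m v = 1%:M.

(* The product of the column [v] with the 1 x 1 matrix [lam%:M] multiplies
   every entry of [v] by [lam] on the right. *)
Definition right_eigenvector n (A : 'M[quat R]_n) (lam : quat R)
    (v : 'cV[quat R]_n) : Prop :=
  v != 0 /\ A *m v = v *m lam%:M.

(* [lam] lists the right eigenvalues of [A] with multiplicity. *)
Definition right_eigenvalues n (A : 'M[quat R]_n) (lam : 'I_n -> R) : Prop :=
  exists V : 'M[quat R]_n, unitaryq V /\
    conjmx V *m A *m V = diag_mx (\row_k realq (lam k)).
End QuatMatrix.

(* Main.v *)
(** Let [V] be a unitary matrix diagonalizing [A], [p(t) = \prod_k (t - lam_k)],
    and let [G = V diag(\prod_(l != k) (t - lam_l)) V^*], so that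
    [(t - A) G = p(t)].  Replacing column [j] of the identity by column [j] of
    [G] gives a matrix [X] for which [(t - A) X] is [t - A] with column [j]
    replaced by [p(t) e_j].  Both are block triangular after moving [j] to the
    front, so taking determinants of the associated real matrices of order
    [4n], where a real scalar contributes its fourth power, yields
      [(p(t) G_jj(t))^4 = (p(t) \prod_k (t - lam_k(M_j)))^4].
    For large [t] both fourth powers have nonnegative bases, hence the polynomials
    [G_jj(t) = \sum_k |V_jk|^2 \prod_(l != k) (t - lam_l)] and
    [\prod_k (t - lam_k(M_j))] agree; evaluate them at [lam_i]. *)

Require Import Defs.
From HB Require Import structures.
From mathcomp Require Import all_boot all_order all_fingroup all_algebra reals ring.
Import Order.TTheory GRing.Theory Num.Theory.
Set Implicit Arguments.
Unset Strict Implicit.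
Unset Printing Implicit Defensive.
Local Open Scope ring_scope.

(* [all_algebra] exports another [conjmx]. *)
Local Notation conjmx := Defs.conjmx.

(** * Quaternionic matrices as real block matrices *)

Section RealRepresentation.
Variable R : realType.
Implicit Types a b : quat R.

(* Row vectors of coordinates are multiplied by the matrix of [x |-> x * a];
   with this convention [quat_mx] preserves the order of products. *)
Definition quat_mx a : 'M[R]_4 := \matrix_(i, j)
  nth 0 (nth [::] [:: [:: qre a; qi a; qj a; qk a];
                      [:: - qi a; qre a; - qk a; qj a];
                      [:: - qj a; qk a; qre a; - qi a];
                      [:: - qk a; - qj a; qi a; qre a]] i) j.

Lemma quat_mx_zmod_morphism : zmod_morphism quat_mx.
Proof.
move=> a b; apply/matrixP => -[[|[|[|[|i]]]] hi] -[[|[|[|[|j]]]] hj] //;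
  rewrite !mxE /=; ring.
Qed.

Lemma quat_mx_monoid_morphism : monoid_morphism quat_mx.
Proof.
split=> [|a b]; apply/matrixP => -[[|[|[|[|i]]]] hi] -[[|[|[|[|j]]]] hj] //;
  rewrite !mxE //= ?oppr0 // !big_ord_recl big_ord0 !mxE /=; ring.
Qed.

HB.instance Definition _ :=
  GRing.isZmodMorphism.Build (quat R) 'M[R]_4 quat_mx quat_mx_zmod_morphism.
HB.instance Definition _ :=
  GRing.isMonoidMorphism.Build (quat R) 'M[R]_4 quat_mx quat_mx_monoid_morphism.

Lemma quat_mx_realq (x : R) : quat_mx (realq x) = x%:M.
Proof.
apply/matrixP => -[[|[|[|[|i]]]] hi] -[[|[|[|[|j]]]] hj] //;
  by rewrite !mxE //= oppr0.
Qed.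

Lemma quat_mx_inj : injective quat_mx.
Proof.
move=> a b /matrixP E.
by apply: quatP; [move: (E 0 0) | move: (E 0 1) | move: (E 0 2%:R)
  | move: (E 0 3%:R)]; rewrite !mxE.
Qed.

Definition study_mx n (A : 'M[quat R]_n) : 'M[R]_(\sum_(i < n) 4) :=
  \mxblock_(i < n, j < n) quat_mx (A i j).

Lemma study_mxM n (A B : 'M[quat R]_n) :
  study_mx (A *m B) = study_mx A *m study_mx B.
Proof.
rewrite /study_mx mul_mxblock; apply: eq_mxblock => i j.
by rewrite mxE raddf_sum; apply: eq_bigr => k _; exact: rmorphM.
Qed.

Lemma study_mx1 n : study_mx (1%:M : 'M[quat R]_n) = 1%:M.
Proof.
rewrite -mxdiagZ; apply: eq_mxblock => i j.
by rewrite mxE; case: eqP => _; rewrite ?conform_mx_id ?rmorph1 ?rmorph0.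
Qed.

Lemma study_mx_inj n : injective (@study_mx n).
Proof.
move=> A B E; apply/matrixP => i j; apply: quat_mx_inj.
by move: i j; apply/eq_mxblockP.
Qed.

(** Passing to real matrices, where a left inverse is also a right inverse, and back by
    injectivity. *)
Lemma unitaryq_mulmx_conj n (V : 'M[quat R]_n) :
  unitaryq V -> V *m conjmx V = 1%:M.
Proof.
move=> VV; apply: study_mx_inj; rewrite study_mxM study_mx1.
by apply: mulmx1C; rewrite -study_mxM VV study_mx1.
Qed.

(** * A determinant for quaternionic matrices *)

Definition study_det n (A : 'M[quat R]_n) : R := \det (study_mx A).

Lemma study_detM n (A B : 'M[quat R]_n) :
  study_det (A *m B) = study_det A * study_det B.
Proof. by rewrite /study_det study_mxM det_mulmx. Qed.

Lemma study_det1 n : study_det (1%:M : 'M[quat R]_n) = 1.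
Proof. by rewrite /study_det study_mx1 det1. Qed.

Lemma det_castmx m n (e e' : m = n) (A : 'M[R]_m) :
  \det (castmx (e, e') A) = \det A.
Proof. by case: n / e e' => e'; rewrite castmx_id. Qed.

Lemma study_det_lblock n (A : 'M[quat R]_n.+1) :
  (forall i, A 0 (lift 0 i) = 0) ->
  study_det A = \det (quat_mx (A 0 0)) * study_det (row' 0 (col' 0 A)).
Proof.
move=> A0; rewrite /study_det /study_mx mxblock_recul det_castmx.
rewrite [X in block_mx _ X](_ : _ = 0) ?det_lblock; last first.
  by rewrite -[RHS]mxrow0; apply: eq_mxrow => i; rewrite A0 rmorph0.
by congr (_ * \det _); apply: eq_mxblock => i j; rewrite !mxE.
Qed.

Lemma study_det_ublock n (A : 'M[quat R]_n.+1) :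
  (forall i, A (lift 0 i) 0 = 0) ->
  study_det A = \det (quat_mx (A 0 0)) * study_det (row' 0 (col' 0 A)).
Proof.
move=> A0; rewrite /study_det /study_mx mxblock_recul det_castmx.
rewrite [X in block_mx _ _ X](_ : _ = 0) ?det_ublock; last first.
  by rewrite -[RHS]mxcol0; apply: eq_mxcol => i; rewrite A0 rmorph0.
by congr (_ * \det _); apply: eq_mxblock => i j; rewrite !mxE.
Qed.

Lemma study_det_diag n (d : 'I_n -> R) :
  study_det (diag_mx (\row_k realq (d k))) = (\prod_k d k) ^+ 4.
Proof.
elim: n d => [|n IHn] d.
  rewrite big_ord0 expr1n -(study_det1 0).
  by congr study_det; apply/matrixP => -[].
rewrite study_det_lblock => [|i]; last by rewrite !mxE /= mulr0n.
rewrite !mxE eqxx mulr1n quat_mx_realq det_scalar big_ord_recl exprMn -IHn.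
congr (_ * study_det _); apply/matrixP => i j.
by rewrite !mxE (inj_eq lift_inj).
Qed.

Lemma realqB (x y : R) : realq (x - y) = realq x - realq y.
Proof. by apply: quatP; rewrite /= ?subr0. Qed.

Lemma realqM (x y : R) : realq (x * y) = realq x * realq y.
Proof. by apply: quatP => /=; ring. Qed.

Lemma mul_realqC (x : R) a : realq x * a = a * realq x.
Proof. by apply: quatP => /=; ring. Qed.

Lemma mulmx_realqC m n (x : R) (A : 'M[quat R]_(m, n)) :
  A *m (realq x)%:M = (realq x)%:M *m A.
Proof.
rewrite mul_scalar_mx -diag_const_mx mul_mx_diag.
by apply/matrixP => k l; rewrite !mxE mul_realqC.
Qed.

(** Conjugation by the unitary [V] preserves [study_det], and the real scalar [t] is central, so
    [t - A] may be replaced by a diagonal matrix. *)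
Lemma study_det_shift n (A : 'M[quat R]_n) (lam : 'I_n -> R) (t : R) :
  right_eigenvalues A lam ->
  study_det ((realq t)%:M - A) = (\prod_k (t - lam k)) ^+ 4.
Proof.
case=> V [VV AV]; rewrite -study_det_diag -[LHS]mul1r -(study_det1 n) -VV.
rewrite study_detM mulrAC -!study_detM mulmxBr mulmxBl AV; congr study_det.
rewrite mulmx_realqC -mulmxA VV mulmx1; apply/matrixP => k l.
by rewrite !mxE realqB; case: eqP => //; rewrite subr0.
Qed.

(** * The determinant identity at a real point *)

(* With [w k = |V_jk|^2], this is the [j]-th diagonal entry of
   [\prod_k (t - lam k) * (t - A)^-1]. *)
Definition cofactor_at n (lam w : 'I_n -> R) (t : R) : R :=
  \sum_k w k * \prod_(l | l != k) (t - lam l).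

(** The case where the deleted index is already in front. Keeping the factor [p] on both sides
    covers the points where [t - A] is singular. *)
Lemma study_det_minor n (A V : 'M[quat R]_n.+1) (lam : 'I_n.+1 -> R)
    (mu : 'I_n -> R) (t : R) :
  unitaryq V -> conjmx V *m A *m V = diag_mx (\row_k realq (lam k)) ->
  right_eigenvalues (row' 0 (col' 0 A)) mu ->
  (\prod_k (t - lam k) * cofactor_at lam (fun k => modq (V 0 k) ^+ 2) t) ^+ 4
  = (\prod_k (t - lam k) * \prod_k (t - mu k)) ^+ 4.
Proof.
move=> VV AV hmu; have VV' := unitaryq_mulmx_conj VV.
set p := \prod_k (t - lam k).
set B := (realq t)%:M - A.
pose G := V *m diag_mx (\row_k realq (\prod_(l | l != k) (t - lam l)))
  *m conjmx V.
have BG : B *m G = (realq p)%:M.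
  have BV : B *m V = V *m diag_mx (\row_k realq (t - lam k)).
    rewrite mulmxBl -mulmx_realqC -[A *m V]mul1mx -VV' -mulmxA.
    rewrite [conjmx V *m _]mulmxA AV.
    rewrite -mulmxBr; congr (_ *m _); apply/matrixP => k l; rewrite !mxE realqB.
    by case: eqP => //; rewrite subr0.
  rewrite !mulmxA BV -(mulmxA V) mulmx_diag.
  rewrite (_ : diag_mx _ = (realq p)%:M); last first.
    apply/matrixP => k l; rewrite !mxE; case: eqP => // _; congr (_ *+ _).
    by rewrite -realqM /p [in RHS](bigD1 k).
  by rewrite mulmx_realqC -mulmxA VV' mulmx1.
have G00 : G 0 0 = realq (cofactor_at lam (fun k => modq (V 0 k) ^+ 2) t).
  rewrite mxE /cofactor_at.
  rewrite (big_morph (@realq R) (id1 := 0) (op1 := +%R)) //; last first.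
    by move=> x y; apply: quatP; rewrite /= ?addr0.
  apply: eq_bigr => k _.
  rewrite mul_mx_diag !mxE -mulrA mul_realqC mulrA mulq_conjq.
  by apply: quatP => /=; ring.
pose X : 'M[quat R]_n.+1 :=
  \matrix_(k, l) if l == 0 then G k 0 else (k == l)%:R.
have detX : study_det X
    = cofactor_at lam (fun k => modq (V 0 k) ^+ 2) t ^+ 4.
  rewrite study_det_lblock => [|k]; last by rewrite !mxE.
  rewrite [X 0 0]mxE eqxx G00 quat_mx_realq det_scalar -[RHS]mulr1 -(study_det1 n).
  congr (_ * study_det _); apply/matrixP => k l.
  by rewrite !mxE /= (inj_eq lift_inj).
have BX k l : (B *m X) k l = if l == 0 then (realq p)%:M k l else B k l.
  case: eqP => [->|/eqP l0].
    by rewrite -BG !mxE; apply: eq_bigr => m _; rewrite !mxE eqxx.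
  rewrite mxE (bigD1 l) //= [X l l]mxE (negPf l0) eqxx mulr1 big1 ?addr0 //.
  by move=> m ml; rewrite [X m l]mxE (negPf l0) (negPf ml) mulr0.
have detBX : study_det (B *m X) = p ^+ 4 * (\prod_k (t - mu k)) ^+ 4.
  (* Below its top entry [p] the first column vanishes, and the remaining block is [t] minus the
     minor. *)
  rewrite study_det_ublock => [|k]; last by rewrite BX mxE.
  rewrite BX eqxx mxE eqxx quat_mx_realq det_scalar -(study_det_shift t hmu).
  congr (_ * study_det _); apply/matrixP => k l.
  by rewrite [LHS]mxE [LHS]mxE BX !mxE /= (inj_eq lift_inj).
rewrite !exprMn -detBX study_detM detX; congr (_ * _).
by rewrite (study_det_shift t (lam := lam)) //; exists V.
Qed.

Lemma study_det_minor_at n (A V : 'M[quat R]_n.+1) (lam : 'I_n.+1 -> R) j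
    (mu : 'I_n -> R) (t : R) :
  unitaryq V -> conjmx V *m A *m V = diag_mx (\row_k realq (lam k)) ->
  right_eigenvalues (row' j (col' j A)) mu ->
  (\prod_k (t - lam k) * cofactor_at lam (fun k => modq (V j k) ^+ 2) t) ^+ 4
  = (\prod_k (t - lam k) * \prod_k (t - mu k)) ^+ 4.
Proof.
(* [s] sends [0] to [j] and keeps the other indices in order, so deleting index [0] after reindexing
   gives exactly the minor at [j]. *)
move=> VV AV hmu; pose s := lift_perm 0 j (1 : 'S_n)%g.
have mul_reindex (B : 'M[quat R]_n.+1) :
    conjmx (rowsub s V) *m rowsub s B = conjmx V *m B.
  apply/matrixP => k l; rewrite !mxE [RHS](reindex_inj (@perm_inj _ s)) /=.
  by apply: eq_bigr => m _; rewrite !mxE.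
have AV_reindex : mxsub s s A *m rowsub s V = rowsub s (A *m V).
  apply/matrixP => k l; rewrite !mxE [RHS](reindex_inj (@perm_inj _ s)) /=.
  by apply: eq_bigr => m _; rewrite !mxE.
have s0 : s 0 = j by rewrite lift_perm_id.
have := @study_det_minor _ (mxsub s s A) (rowsub s V) lam mu t.
rewrite /cofactor_at; under [\sum_k _]eq_bigr do rewrite mxE s0; apply.
- by rewrite /unitaryq mul_reindex.
- by rewrite -mulmxA AV_reindex mul_reindex mulmxA.
- rewrite (_ : row' _ _ = row' j (col' j A)) //; apply/matrixP => k l.
  by rewrite !mxE !lift_perm_lift !perm1.
Qed.

(** * From fourth powers to a polynomial identity *)

Lemma poly_eq_eventually (p q : {poly R}) (c : R) :
  (forall t, c < t -> p.[t] = q.[t]) -> p = q.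
Proof.
move=> pq; apply/eqP; rewrite -subr_eq0; apply/negPn/negP => d0.
(* As many distinct roots as the size of [p - q], one more than its degree allows. *)
pose rs := [seq c + m.+1%:R | m <- iota 0 (size (p - q))].
have := max_poly_roots (rs := rs) d0; rewrite size_map size_iota ltnn.
have -> : uniq rs.
  rewrite map_inj_uniq ?iota_uniq // => m1 m2 /addrI/eqP.
  by rewrite eqr_nat => /eqP[].
have -> : all (root (p - q)) rs; last by move/(_ isT isT).
apply/allP => _ /mapP[m _ ->]; rewrite rootE hornerD hornerN pq ?subrr //.
by rewrite ltrDl ltr0Sn.
Qed.

(** Going through polynomials reaches the eigenvalues themselves, where the common factor vanishes
    and cannot be cancelled. *)
Lemma cofactor_at_minor n (A V : 'M[quat R]_n.+1) (lam : 'I_n.+1 -> R) j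
    (mu : 'I_n -> R) (t : R) :
  unitaryq V -> conjmx V *m A *m V = diag_mx (\row_k realq (lam k)) ->
  right_eigenvalues (row' j (col' j A)) mu ->
  cofactor_at lam (fun k => modq (V j k) ^+ 2) t = \prod_k (t - mu k).
Proof.
move=> VV AV hmu.
pose P := \sum_k modq (V j k) ^+ 2 *: \prod_(l | l != k) ('X - (lam l)%:P).
pose Q := \prod_k ('X - (mu k)%:P).
have PE u : cofactor_at lam (fun k => modq (V j k) ^+ 2) u = P.[u].
  rewrite horner_sum; apply: eq_bigr => k _; rewrite hornerZ horner_prod.
  by congr (_ * _); apply: eq_bigr => l _; rewrite hornerXsubC.
have QE u : \prod_k (u - mu k) = Q.[u].
  by rewrite horner_prod; apply: eq_bigr => k _; rewrite hornerXsubC.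
rewrite PE QE; congr (_.[_]).
have le_sum m (f : 'I_m -> R) k : f k <= \sum_l `|f l|.
  by rewrite (bigD1 k) //= ler_wpDr ?sumr_ge0 ?ler_norm.
(* This bound dominates every [lam k] and [mu k], so beyond it all linear factors are positive. *)
apply: (@poly_eq_eventually _ _ (\sum_l `|lam l| + \sum_l `|mu l|)) => u cu.
have lam_u k : 0 < u - lam k.
  rewrite subr_gt0 (le_lt_trans _ cu) // ler_wpDr ?sumr_ge0 //; exact: le_sum.
have mu_u k : 0 < u - mu k.
  rewrite subr_gt0 (le_lt_trans _ cu) // ler_wpDl ?sumr_ge0 //; exact: le_sum.
have lam_gt0 : 0 < \prod_k (u - lam k) by apply: prodr_gt0.
have /eqP := study_det_minor_at u VV AV hmu.
rewrite -PE -QE eqrXn2 //; first by move/eqP/(mulfI (lt0r_neq0 lam_gt0)).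
- rewrite mulr_ge0 ?(ltW lam_gt0) // sumr_ge0 // => k _.
  by rewrite mulr_ge0 ?sqr_ge0 // prodr_ge0 // => l _; rewrite ltW.
- by rewrite ltW // mulr_gt0 // prodr_gt0.
Qed.

(** * Evaluation at an eigenvalue and comparison of eigenvectors *)

Lemma cofactor_at_eigenvalue n (lam w : 'I_n -> R) i :
  cofactor_at lam w (lam i) = w i * \prod_(k | k != i) (lam i - lam k).
Proof.
rewrite /cofactor_at (bigD1 i) //= [X in _ + X]big1 ?addr0 // => k ki.
by rewrite (bigD1 i) 1?eq_sym //= subrr mul0r mulr0.
Qed.

(** Euler's four-square identity. *)
Lemma sqr_modqM a b : modq (a * b) ^+ 2 = modq a ^+ 2 * modq b ^+ 2.
Proof.
have sqE c : modq c ^+ 2 = qre (c * conjq c) by rewrite mulq_conjq.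
by rewrite !sqE /=; ring.
Qed.

Lemma sum_modq_col m n (B : 'M[quat R]_(m, n)) i :
  \sum_k modq (B k i) ^+ 2 = qre ((conjmx B *m B) i i).
Proof.
rewrite mxE (big_morph (@qre R) (id1 := 0) (op1 := +%R)) //.
by apply: eq_bigr => k _; rewrite !mxE conjq_mul.
Qed.

(* A unit eigenvector of a simple eigenvalue is a unit multiple of the
   corresponding column of the diagonalizing unitary matrix. *)
Lemma modq_simple_eigenvector n (A V : 'M[quat R]_n) (lam : 'I_n -> R) i j
    (v : 'cV[quat R]_n) :
  unitaryq V -> conjmx V *m A *m V = diag_mx (\row_k realq (lam k)) ->
  A *m v = v *m (realq (lam i))%:M -> unit_vectorq v ->
  (forall k, k != i -> lam k != lam i) ->
  modq (v j 0) ^+ 2 = modq (V j i) ^+ 2.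
Proof.
move=> VV AV Av v1 simple; have VV' := unitaryq_mulmx_conj VV.
(* Coordinates of [v] in the eigenbasis; simplicity leaves only the [i]-th one. *)
pose w := conjmx V *m v.
have vE : v = V *m w by rewrite mulmxA VV' mul1mx.
have Dw : diag_mx (\row_k realq (lam k)) *m w = w *m (realq (lam i))%:M.
  by rewrite -AV -!mulmxA -vE Av.
have w0 k : k != i -> w k 0 = 0.
  move=> ki; move/matrixP/(_ k 0): Dw.
  rewrite mulmx_realqC mul_scalar_mx mul_diag_mx mxE [RHS]mxE mxE.
  move/eqP; rewrite -subr_eq0 -mulrBl -realqB => /eqP.
  move/(congr1 (fun a => realq (lam k - lam i)^-1 * a)).
  rewrite mulrA -realqM mulVf ?subr_eq0 ?simple // mulr0 => wk0.
  by rewrite -[LHS]mul1r.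
have vkE k : v k 0 = V k i * w i 0.
  rewrite {1}vE mxE (bigD1 i) //= big1 ?addr0 // => l li.
  by rewrite w0 // mulr0.
(* The modulus of [w i 0] is found by comparing the norms of [v] and of column [i] of [V], both
   1. *)
suff wi1 : modq (w i 0) ^+ 2 = 1 by rewrite vkE sqr_modqM wi1 mulr1.
have sumV : \sum_k modq (V k i) ^+ 2 = 1 by rewrite sum_modq_col VV mxE eqxx.
have sumv : \sum_k modq (v k 0) ^+ 2 = 1 by rewrite sum_modq_col v1 mxE eqxx.
rewrite -[RHS]sumv; under [RHS]eq_bigr do rewrite vkE sqr_modqM.
by rewrite -mulr_suml sumV mul1r.
Qed.
End RealRepresentation.

Theorem theorem3p2 (R : realType) (n : nat) (A : 'M[quat R]_n)
    (hA : hermitianq A)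
    (lamA : 'I_n -> R) (hlamA : right_eigenvalues A lamA)
    (i j : 'I_n) (v : 'cV[quat R]_n)
    (hv : right_eigenvector A (realq (lamA i)) v) (hv1 : unit_vectorq v)
    (lamM : 'I_n.-1 -> R)
    (hlamM : right_eigenvalues (row' j (col' j A)) lamM) :
  modq (v j 0) ^+ 2 * \prod_(k < n | k != i) (lamA i - lamA k)
  = \prod_(k < n.-1) (lamA i - lamM k).
Proof.
case: n A hA lamA hlamA i j v hv hv1 lamM hlamM => [|n] A _ lamA [V [VV AV]] i j.
  by case: i.
move=> v [_ Av] v1 lamM hlamM.
rewrite -(cofactor_at_minor (lamA i) VV AV hlamM) cofactor_at_eigenvalue.
(* For a repeated eigenvalue [v] need not match column [i] of [V], but both sides vanish; otherwise
   the eigenvalue is simple. *)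
have [->|prod0] := eqVneq (\prod_(k | k != i) (lamA i - lamA k)) 0.
  by rewrite !mulr0.
rewrite (modq_simple_eigenvector j VV AV Av v1) // => k ki.
by apply: contraNneq prod0 => lam_eq; rewrite (bigD1 k) //= lam_eq subrr mul0r.
Qed.
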